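(* Suppose $s\le \overline{s}_K$ and consider stable equilibria with active search (with search intensity $q^U$ in the model where consumers do not observe the marginal cost of production, and search intensity $q(c_k)$, for each $k\in\{1,\dots,K\}$, in the model where consumers observe that the marginal cost is $c_k$). Then, in expectation (over the marginal cost), (i) consumers search more, i.e. $q^U>\sum_{k=1}^K f_k\,q(c_k)$, (ii) the consumer surplus is higher, i.e. $CS^U>\sum_{k=1}^K f_k\,CS(c_k)$, (iii) the firm profit is lower, i.e. $\Pi^U<\sum_{k=1}^K f_k\,\pi(c_k)$, and (iv) the total surplus is lower, i.e. $CS^U+N\Pi^U<\sum_{k=1}^K f_k\,\bigl(CS(c_k)+N\pi(c_k)\bigr)$, when consumers do not observe the marginal cost of production than when they do.
   Context: Model. $N\ge 2$ identical firms sell a homogeneous good to a unit mass of consumers, each of whom wishes to consume one unit, valued at $v$. The marginal cost of production, common to all firms, is a random draw from $\{c_1,\dots,c_K\}$, where $0\le c_1\le\dots\le c_K<v$, with probability mass function $f=(f_1,\dots,f_K)$ ($f_k$ is the probability of $c_k$). Firms observe the cost and simultaneously set prices (mixed strategies allowed). Consumers do not observe prices; each chooses a number $m\in\{1,\dots,N\}$ of firms to search simultaneously, pays $(m-1)s$, where $s>0$ is the search cost, and may buy at the lowest observed price. In one version of the model consumers do not observe the marginal cost (solution concept: Bayesian-Nash equilibrium); in the other they observe it and can condition their search on it (Nash equilibrium for each realized cost). An equilibrium with active search is one in which some consumers search more than one firm. In such an equilibrium a share $q\in(0,1)$ of consumers (the search intensity) searches two firms and the share $1-q$ searches one firm, and,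 when the cost is $c_k$, each firm charges a price above $p$ with probability $$x_k(p)=\frac{1-q}{2q}\left(\frac{v-c_k}{p-c_k}-1\right)\quad\text{on } [\underline p_k,v],\qquad x_k(\underline p_k)=1 .$$ The inverse function of $x_k$ is, for $x\in[0,1]$, $$p_k(x;q)=\frac{(1-q)(v-c_k)}{1-q+2qx}+c_k .$$ Unobserved cost: the search intensity $q^U\in(0,1)$ of an equilibrium with active search solves $\sum_{k=1}^K f_k\int_0^1 p_k(x;q^U)(1-2x)\,dx=s$. Observed cost: for each $k$, the search intensity $q(c_k)\in(0,1)$ of an equilibrium with active search solves $\int_0^1 p_k(x;q(c_k))(1-2x)\,dx=s$. In each equation the left-hand side is the expected benefit of searching a second firm. It is strictly concave in the search intensity on $(0,1)$ and tends to zero at both ends, so that for small $s$ there are two equilibria with active search. Stability: an equilibrium with active search is stable if, whenever the actual search intensity is in a small neighborhood of the equilibrium search intensity, consumers optimally adjust their search intensity to the equilibrium one (consumers having an incentive to search more when the expected benefit of searching a second firm exceeds $s$, and less when it is below $s$). Of the two equilibria with active search, the one with the higher search intensity is stable. Threshold: $\overline{s}_K=\max_{q\in(0,1)}\int_0^1 p_K(x;q)(1-2x)\,dx$. Welfare quantities: the consumer surplus is $CS^U=v-\sum_{k=1}^K f_k\int_0^1 p_k(x;q^U)(1-q^U+2q^Ux)\,dx-q^Us$ when the cost is unobserved, and $CS(c_k)=v-\int_0^1 p_k(x;q(c_k))(1-q(c_k)+2q(c_k)x)\,dx-q(c_k)s$ when it is observed to be $c_k$. The expected equilibrium profit of a firm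 is $\Pi^U=\sum_{k=1}^K f_k(1-q^U)(v-c_k)/N$ when the cost is unobserved, and $\pi(c_k)=(1-q(c_k))(v-c_k)/N$ when it is observed to be $c_k$. Total surplus is consumer surplus plus the sum of the $N$ firms' profits.
   Formalization: It is additionally assumed that two different marginal costs have positive probability; if the cost is degenerate (for example K=1 or all c_k equal), the two regimes coincide and the strict inequalities (i)–(iv) fail. *)

(* Defs.v *)
From Stdlib Require Import Reals.
From Coquelicot Require Import Coquelicot.
Open Scope R_scope.

(* Marginal costs are [c 1, ..., c K] with probabilities [f 1, ..., f K];
   values of [c] and [f] at other indices are irrelevant. *)
Definition expect (K : nat) (f g : nat -> R) : R :=
  sum_n_m (fun k => f k * g k) 1 K.

Definition is_pmf (K : nat) (f : nat -> R) : Prop :=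
  (forall k : nat, (1 <= k <= K)%nat -> 0 <= f k) /\ sum_n_m f 1 K = 1.

(* The strict comparisons between the two information regimes fail for a
   degenerate cost, so two different costs must have positive probability. *)
Definition random_cost (K : nat) (f c : nat -> R) : Prop :=
  exists i j : nat, (1 <= i <= K)%nat /\ (1 <= j <= K)%nat /\
    0 < f i /\ 0 < f j /\ c i < c j.

(* The price exceeded with probability [x] when the cost is [c] and a share
   [q] of consumers searches two firms and [1 - q] searches one: the inverse of
   p |-> (1 - q) / (2 q) * ((v - c) / (p - c) - 1). *)
Definition price (v c q x : R) : R :=
  (1 - q) * (v - c) / (1 - q + 2 * q * x) + c.

(* Expected price minus expected lower of two prices. *)
Definition benefit (v c q : R) : R :=
  RInt (fun x => price v c q x * (1 - 2 * x)) 0 1.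

Definition benefitU (K : nat) (f c : nat -> R) (v q : R) : R :=
  expect K f (fun k => benefit v (c k) q).

(* [B q] is the expected benefit of searching a second firm at cost [s] when
   the search intensity is [q]. *)
Definition active_search (B : R -> R) (s q : R) : Prop :=
  0 < q < 1 /\ B q = s.

(* Near [q], consumers gain from searching more below [q] and from searching
   less above [q]. *)
Definition adjusts_to (B : R -> R) (s q : R) : Prop :=
  exists eps : R, 0 < eps /\
    forall q' : R, 0 < q' < 1 -> Rabs (q' - q) < eps ->
      (q' < q -> s < B q') /\ (q < q' -> B q' < s).

Definition is_max_on_01 (B : R -> R) (m : R) : Prop :=
  (exists q : R, 0 < q < 1 /\ B q = m) /\
  (forall q : R, 0 < q < 1 -> B q <= m).

(* The second alternative is the boundary case where [s] is the maximal benefit: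
   the two equilibria with active search then coincide, and the resulting one,
   attracting only from above, is counted as the higher, stable one. *)
Definition stable_active_search (B : R -> R) (s q : R) : Prop :=
  active_search B s q /\ (adjusts_to B s q \/ is_max_on_01 B s).

(* A share [1 - q] pays one price draw and a share [q] the lower of two, which
   gives the weight (1 - q) + q * (2 x). *)
Definition expenditure (v c q : R) : R :=
  RInt (fun x => price v c q x * (1 - q + 2 * q * x)) 0 1.

Definition CS (v s c q : R) : R := v - expenditure v c q - q * s.

Definition CSU (K : nat) (f c : nat -> R) (v s q : R) : R :=
  v - expect K f (fun k => expenditure v (c k) q) - q * s.

Definition profit (N : nat) (v c q : R) : R := (1 - q) * (v - c) / INR N.

Definition profitU (N K : nat) (f c : nat -> R) (v q : R) : R :=
  expect K f (fun k => profit N v (c k) q).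

(* Main.v *)
(* With [w = v - c], the benefit of a second search is [w * (1 - g q)], where
   [g q] is the mean of [1 / (1 - q + 2 q x)] for the density [2 x] on [0, 1],
   and the consumer surplus is [q * (w - s)].  So [1 / g] is a harmonic mean of
   functions affine in [q], hence strictly concave, and so is the benefit; a
   stable [qU] is then exceeded only by intensities whose benefit is at most [s].
   Since [g (q k) = 1 - s / w k] and [g qU = 1 - s / E w], Jensen's inequality
   for [1 - g] gives [E q < qU], and Jensen's inequality for [1 / g] with the
   weights [w k - s] gives [E (q (w - s)) < qU * (E w - s)].  Their combination
   compares profits, and total surplus [w - q * s] depends only on [E q]. *)

Require Import Defs.
From Stdlib Require Import Reals Lra Lia.
From Coquelicot Require Import Coquelicot.
Open Scope R_scope.

(** * Expectations over the random cost *)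

Lemma expect_ext (K : nat) (f u w : nat -> R) :
  (forall k, (1 <= k <= K)%nat -> u k = w k) -> expect K f u = expect K f w.
Proof.
  intros H; apply sum_n_m_ext_loc; intros k Hk; now rewrite (H k Hk).
Qed.

Lemma expect_plus (K : nat) (f u w : nat -> R) :
  expect K f (fun k => u k + w k) = expect K f u + expect K f w.
Proof.
  unfold expect.
  rewrite <- (sum_n_m_plus (G := R_AbelianMonoid)).
  apply sum_n_m_ext; intros k; simpl; unfold plus; simpl; ring.
Qed.

Lemma expect_scal (K : nat) (f u : nat -> R) (a : R) :
  expect K f (fun k => a * u k) = a * expect K f u.
Proof.
  unfold expect.
  rewrite <- (sum_n_m_mult_l (K := R_Ring)).
  apply sum_n_m_ext; intros k; unfold mult; simpl; ring.
Qed.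

Lemma expect_const (K : nat) (f : nat -> R) (a : R) :
  is_pmf K f -> expect K f (fun _ => a) = a.
Proof.
  intros [_ H].
  transitivity (a * sum_n_m f 1 K); [|rewrite H; ring].
  unfold expect.
  rewrite <- (sum_n_m_mult_l (K := R_Ring)).
  apply sum_n_m_ext; intros k; unfold mult; simpl; ring.
Qed.

Lemma expect_nonneg (K : nat) (f u : nat -> R) :
  (forall k, (1 <= k <= K)%nat -> 0 <= f k) ->
  (forall k, (1 <= k <= K)%nat -> 0 <= u k) ->
  0 <= expect K f u.
Proof.
  unfold expect; induction K as [|K IH]; intros Hf Hu.
  - rewrite sum_n_m_zero; [apply Rle_refl | lia].
  - rewrite sum_n_Sm; [|lia].
    apply Rplus_le_le_0_compat.
    + apply IH; intros k Hk; [apply Hf | apply Hu]; lia.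
    + apply Rmult_le_pos; [apply Hf | apply Hu]; lia.
Qed.

Lemma expect_pos (K : nat) (f u : nat -> R) (i : nat) :
  (forall k, (1 <= k <= K)%nat -> 0 <= f k) ->
  (forall k, (1 <= k <= K)%nat -> 0 <= u k) ->
  (1 <= i <= K)%nat -> 0 < f i -> 0 < u i ->
  0 < expect K f u.
Proof.
  induction K as [|K IH]; intros Hf Hu Hi Hfi Hui; [lia|].
  unfold expect; rewrite sum_n_Sm; [|lia].
  destruct (Nat.eq_dec i (S K)) as [->|Hne].
  - apply Rplus_le_lt_0_compat; [|now apply Rmult_lt_0_compat].
    apply expect_nonneg; intros k Hk; [apply Hf | apply Hu]; lia.
  - apply Rplus_lt_le_0_compat.
    + apply IH; try assumption; try lia;
        intros k Hk; [apply Hf | apply Hu]; lia.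
    + apply Rmult_le_pos; [apply Hf | apply Hu]; lia.
Qed.

(** Partial sums of [f] stay zero until a positive weight occurs, and the full sum is one. *)
Lemma pmf_support (K : nat) (f : nat -> R) :
  is_pmf K f -> exists i, (1 <= i <= K)%nat /\ 0 < f i.
Proof.
  intros [Hf Hs].
  assert (H : forall n, (n <= K)%nat ->
    sum_n_m f 1 n = 0 \/ exists i, (1 <= i <= K)%nat /\ 0 < f i).
  { induction n as [|n IH]; intros Hn.
    - left; now rewrite sum_n_m_zero by lia.
    - destruct (Rle_lt_or_eq_dec 0 (f (S n)) (Hf (S n) ltac:(lia))) as [H|H].
      + right; exists (S n); split; [lia|assumption].
      + destruct (IH ltac:(lia)) as [H0|H0]; [left|now right].
        rewrite sum_n_Sm by lia. rewrite H0, <- H. apply Rplus_0_l. }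
  destruct (H K (le_n K)) as [H0|H0]; [lra|exact H0].
Qed.

(** * The function g, here [hmean], and closed forms of benefit and expenditure *)

Definition hmean (q : R) : R := RInt (fun x => 2 * x / (1 - q + 2 * q * x)) 0 1.

Lemma mix_pos (q x : R) : 0 < q < 1 -> 0 <= x -> 0 < 1 - q + 2 * q * x.
Proof. intros; nra. Qed.

Lemma is_RInt_hmean (q : R) : 0 < q < 1 ->
  is_RInt (fun x => 2 * x / (1 - q + 2 * q * x)) 0 1 (hmean q).
Proof.
  intros Hq; apply (RInt_correct (V := R_CompleteNormedModule)).
  apply (ex_RInt_continuous (V := R_CompleteNormedModule)).
  rewrite Rmin_left, Rmax_right by lra; intros x Hx.
  apply (ex_derive_continuous (K := R_AbsRing) (V := R_NormedModule)).
  pose proof (mix_pos q x Hq (proj1 Hx)); auto_derive; lra.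
Qed.

Lemma hmean_pos (q : R) : 0 < q < 1 -> 0 < hmean q.
Proof.
  intros Hq; apply RInt_gt_0; [lra| |]; intros x Hx.
  - apply Rdiv_lt_0_compat; [lra|apply mix_pos; lra].
  - apply (ex_derive_continuous (K := R_AbsRing) (V := R_NormedModule)).
    pose proof (mix_pos q x Hq (proj1 Hx)); auto_derive; lra.
Qed.

Lemma is_RInt_antiderivative (F u : R -> R) (a b l : R) :
  (forall x, is_derive F x (u x)) -> (forall x, continuous u x) ->
  F b - F a = l -> is_RInt u a b l.
Proof.
  intros HF Hu <-; apply (is_RInt_derive (V := R_CompleteNormedModule)); auto.
Qed.

(** With L = 1 - q + 2 q x one has (1 - q) (1 - 2 x) = L - 2 x, so the integrand is (v - c) (1 - 2 x
    / L) + c (1 - 2 x), and the last term integrates to zero. *)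
Lemma benefit_hmean (v c q : R) :
  0 < q < 1 -> benefit v c q = (v - c) * (1 - hmean q).
Proof.
  intros Hq; apply (is_RInt_unique (V := R_CompleteNormedModule)).
  assert (H0 : is_RInt (fun x => (v - c) + c * (1 - 2 * x)) 0 1 (v - c)).
  { apply (is_RInt_antiderivative (fun x => (v - c) * x + c * (x - x * x)));
      [| |ring]; intros x.
    - auto_derive; [exact I|ring].
    - apply (ex_derive_continuous (K := R_AbsRing) (V := R_NormedModule)).
      auto_derive; exact I. }
  pose proof (is_RInt_minus _ _ _ _ _ _ H0
    (is_RInt_scal _ _ _ (v - c) _ (is_RInt_hmean q Hq))) as H.
  replace ((v - c) * (1 - hmean q)) with (minus (v - c) (scal (v - c) (hmean q)))
    by (unfold minus, plus, opp, scal; simpl; unfold mult; simpl; ring).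
  apply (is_RInt_ext (V := R_NormedModule)) with (2 := H).
  rewrite Rmin_left, Rmax_right by lra; intros x Hx.
  unfold price, minus, plus, opp, scal; simpl; unfold mult; simpl.
  pose proof (mix_pos q x Hq ltac:(lra)); field; lra.
Qed.

(** The weight cancels the denominator of [price], and the weight itself has integral one. *)
Lemma expenditure_eq (v c q : R) :
  0 < q < 1 -> expenditure v c q = (1 - q) * (v - c) + c.
Proof.
  intros Hq; apply (is_RInt_unique (V := R_CompleteNormedModule)).
  apply (is_RInt_ext (V := R_NormedModule))
    with (f := fun x => (1 - q) * (v - c) + c * (1 - q + 2 * q * x)).
  { rewrite Rmin_left, Rmax_right by lra; intros x Hx; unfold price.
    pose proof (mix_pos q x Hq ltac:(lra)); simpl; field; lra. }
  apply (is_RInt_antiderivative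
    (fun x => (1 - q) * (v - c) * x + c * ((1 - q) * x + q * (x * x))));
    [| |ring]; intros x.
  - auto_derive; [exact I|ring].
  - apply (ex_derive_continuous (K := R_AbsRing) (V := R_NormedModule)).
    auto_derive; exact I.
Qed.

(** * Convexity properties of [hmean] and their consequence at stable intensities *)

Lemma RInt_gt_0_except (F : R -> R) (z : R) :
  (forall x, 0 < x < 1 -> x <> z -> 0 < F x) ->
  (forall x, 0 <= x <= 1 -> continuous F x) ->
  0 < RInt F 0 1.
Proof.
  intros Hpos Hcont.
  destruct (Rlt_dec 0 z) as [H0|H0]; [destruct (Rlt_dec z 1) as [H1|H1]|].
  - assert (Hex : forall a b, 0 <= a -> a <= b -> b <= 1 -> ex_RInt F a b).
    { intros a b Ha Hab Hb.
      apply (ex_RInt_continuous (V := R_CompleteNormedModule)).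
      rewrite Rmin_left, Rmax_right by lra; intros x Hx; apply Hcont; lra. }
    rewrite <- (RInt_Chasles F 0 z 1) by (apply Hex; lra).
    apply Rplus_lt_0_compat; apply RInt_gt_0; intros; try lra;
      try (apply Hpos; lra); apply Hcont; lra.
  - apply RInt_gt_0; [lra| |assumption]; intros x Hx; apply Hpos; lra.
  - apply RInt_gt_0; [lra| |assumption]; intros x Hx; apply Hpos; lra.
Qed.

(* The tangent inequality at [Q] for the strictly concave function [1 / hmean],
   with denominators cleared. *)
Lemma hmean_tangent (Q : R) : 0 < Q < 1 ->
  exists D, forall q, 0 < q < 1 -> q <> Q ->
    hmean Q ^ 2 < hmean q * (hmean Q + D * (q - Q)).
Proof.
  intros HQ.
  (* Minus the derivative in q, at [Q], of the integrand of [hmean]. Its integral is thus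
     [hmean Q ^ 2] times the slope of [1 / hmean] at [Q]. *)
  set (d := fun x => 2 * x * (2 * x - 1) / (1 - Q + 2 * Q * x) ^ 2).
  exists (RInt d 0 1); intros q Hq Hne.
  assert (HD : is_RInt d 0 1 (RInt d 0 1)).
  { apply (RInt_correct (V := R_CompleteNormedModule)).
    apply (ex_RInt_continuous (V := R_CompleteNormedModule)).
    rewrite Rmin_left, Rmax_right by lra; intros x Hx.
    apply (ex_derive_continuous (K := R_AbsRing) (V := R_NormedModule)).
    pose proof (mix_pos Q x HQ (proj1 Hx)); unfold d; auto_derive; nra. }
  pose proof (hmean_pos q Hq) as Hgq; pose proof (hmean_pos Q HQ) as HgQ.
  set (D := RInt d 0 1) in *.
  (* With this factor the integral of the square below becomes [hmean q / hmean Q ^ 2] times the gap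
     in the claimed inequality. *)
  set (a := hmean q / hmean Q).
  (* Cauchy-Schwarz for [sqrt (1 / L q)] and [sqrt (L q) / L Q], where
     [L q = 1 - q + 2 q x]: integrate the square that makes it an inequality. *)
  set (F := fun x => 2 * x * (1 - Q + 2 * Q * x - a * (1 - q + 2 * q * x)) ^ 2
                     / ((1 - Q + 2 * Q * x) ^ 2 * (1 - q + 2 * q * x))).
  (* Expand the square and use L q = L Q + (q - Q) (2 x - 1) in its last term. *)
  assert (HF : is_RInt F 0 1
      (hmean q + ((a ^ 2 - 2 * a) * hmean Q + a ^ 2 * (q - Q) * D))).
  { apply (is_RInt_ext (V := R_NormedModule)) with (2 :=
      is_RInt_plus _ _ _ _ _ _ (is_RInt_hmean q Hq)
       (is_RInt_plus _ _ _ _ _ _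
         (is_RInt_scal _ _ _ (a ^ 2 - 2 * a) _ (is_RInt_hmean Q HQ))
         (is_RInt_scal _ _ _ (a ^ 2 * (q - Q)) _ HD))).
    rewrite Rmin_left, Rmax_right by lra; intros x Hx.
    pose proof (mix_pos q x Hq ltac:(lra)); pose proof (mix_pos Q x HQ ltac:(lra)).
    unfold F, d, plus, scal; simpl; unfold mult; simpl; field; lra. }
  assert (Hpos : 0 < RInt F 0 1).
  (* The excluded point is the zero of L Q - a L q, which is affine in x. If its slope vanishes, a
     zero would force a = 1 and then q = Q. *)
  { apply RInt_gt_0_except with (- (1 - Q - a * (1 - q)) / (2 * (Q - a * q))).
    - intros x Hx Hxz.
      pose proof (mix_pos q x Hq ltac:(lra)) as Lq.
      pose proof (mix_pos Q x HQ ltac:(lra)) as LQ.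
      apply Rdiv_lt_0_compat;
        [|apply Rmult_lt_0_compat; [apply pow_lt|]; assumption].
      apply Rmult_lt_0_compat; [lra|].
      rewrite <- Rsqr_pow2; apply Rlt_0_sqr; intros E.
      destruct (Req_dec (Q - a * q) 0) as [Hs|Hs].
      + apply Hne; assert (a = 1) by nra; nra.
      + apply Hxz; apply Rmult_eq_reg_r with (2 * (Q - a * q)); [|lra].
        field_simplify; [nra|lra].
    - intros x Hx.
      pose proof (mix_pos q x Hq ltac:(lra)) as Lq.
      pose proof (mix_pos Q x HQ ltac:(lra)) as LQ.
      apply (ex_derive_continuous (K := R_AbsRing) (V := R_NormedModule)).
      unfold F; auto_derive; repeat apply conj; try exact I.
      apply Rgt_not_eq; repeat apply Rmult_lt_0_compat; lra. }
  rewrite (is_RInt_unique (V := R_CompleteNormedModule) _ _ _ _ HF) in Hpos.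
  replace (hmean q + _) with
    (hmean q / hmean Q ^ 2 * (hmean q * (hmean Q + D * (q - Q)) - hmean Q ^ 2))
    in Hpos by (unfold a; field; lra).
  assert (0 < hmean q / hmean Q ^ 2)
    by (apply Rdiv_lt_0_compat; [|apply pow_lt]; assumption).
  nra.
Qed.

(** Put e = D (q - Q) with D from [hmean_tangent]. There [hmean Q + e] must be positive, and (hmean
    Q - e) (hmean Q + e) <= hmean Q ^ 2, so dividing by it gives the claim. *)
Lemma hmean_convex (Q : R) : 0 < Q < 1 ->
  exists D, forall q, 0 < q < 1 -> q <> Q ->
    hmean Q - D * (q - Q) < hmean q.
Proof.
  intros HQ; destruct (hmean_tangent Q HQ) as [D HD]; exists D; intros q Hq Hne.
  specialize (HD q Hq Hne).
  pose proof (hmean_pos q Hq); pose proof (hmean_pos Q HQ).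
  set (e := D * (q - Q)) in *; nra.
Qed.

(** Unless [s] is the maximal benefit, stability yields a point [q'] just right of [q] with benefit
    below [s]. So [hmean] rises from [q] to [q'], and by convexity it keeps rising up to [Q]. *)
Lemma stable_right (B : R -> R) (w s q Q : R) :
  0 < w -> (forall q', 0 < q' < 1 -> B q' = w * (1 - hmean q')) ->
  stable_active_search B s q -> q <= Q < 1 -> w * (1 - hmean Q) <= s.
Proof.
  intros Hw HB [[Hq HBq] Hst] HQ.
  destruct (Req_dec q Q) as [<-|Hne]; [rewrite <- HB; lra|].
  rewrite <- HB by lra.
  destruct Hst as [(eps & Heps & Had)|[_ Hmax]]; [|apply Hmax; lra].
  set (q' := Rmin (q + eps / 2) ((q + Q) / 2)).
  assert (Hq' : q < q' < Q /\ q' <= q + eps / 2).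
  { unfold q', Rmin; destruct (Rle_dec _ _); lra. }
  destruct (Had q') as [_ Hlt]; [lra|rewrite Rabs_pos_eq; lra|].
  specialize (Hlt ltac:(lra)).
  destruct (hmean_convex q') as [D HD]; [lra|].
  pose proof (HD q ltac:(lra) ltac:(lra)) as H1.
  pose proof (HD Q ltac:(lra) ltac:(lra)) as H2.
  rewrite HB in * by lra.
  assert (hmean q < hmean q') by nra.
  assert (D < 0) by nra.
  assert (0 < - D * (Q - q')) by (apply Rmult_lt_0_compat; lra).
  nra.
Qed.

Theorem proposition3 (N K : nat) (f c : nat -> R) (v s sbar : R)
    (qU : R) (q : nat -> R)
    (hN : (2 <= N)%nat) (hK : (1 <= K)%nat)
    (hc0 : 0 <= c 1%nat)
    (hc : forall i j : nat, (1 <= i)%nat -> (i <= j)%nat -> (j <= K)%nat ->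
            c i <= c j)
    (hv : c K < v)
    (hf : is_pmf K f)
    (hrandom : random_cost K f c)
    (hs : 0 < s)
    (hsbar : is_max_on_01 (benefit v (c K)) sbar)
    (hs_sbar : s <= sbar)
    (hqU : stable_active_search (benefitU K f c v) s qU)
    (hq : forall k : nat, (1 <= k <= K)%nat ->
            stable_active_search (benefit v (c k)) s (q k)) :
  qU > expect K f q /\
  CSU K f c v s qU > expect K f (fun k => CS v s (c k) (q k)) /\
  profitU N K f c v qU < expect K f (fun k => profit N v (c k) (q k)) /\
  CSU K f c v s qU + INR N * profitU N K f c v qU <
    expect K f (fun k => CS v s (c k) (q k) + INR N * profit N v (c k) (q k)).
Proof.
  pose proof (proj1 hf) as Hf0.
  set (w := fun k => v - c k).
  assert (Hw : forall k, (1 <= k <= K)%nat -> 0 < w k).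
  { intros k Hk; pose proof (hc k K ltac:(lia) ltac:(lia) ltac:(lia)).
    unfold w; lra. }
  assert (Hq : forall k, (1 <= k <= K)%nat ->
            0 < q k < 1 /\ w k * (1 - hmean (q k)) = s).
  { intros k Hk; destruct (hq k Hk) as [[H1 H2] _].
    rewrite benefit_hmean in H2 by exact H1; auto. }
  assert (Hws : forall k, (1 <= k <= K)%nat -> 0 < w k - s).
  { intros k Hk; destruct (Hq k Hk) as [H1 H2].
    pose proof (Hw k Hk); pose proof (hmean_pos _ H1); nra. }
  destruct (pmf_support K f hf) as (i0 & Hi0 & Hfi0).
  set (m := expect K f w).
  assert (Hm : s < m).
  { enough (0 < m - s) by lra.
    replace (m - s) with (expect K f (fun k => w k + - s))
      by (rewrite expect_plus, (expect_const _ _ _ hf); reflexivity).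
    apply expect_pos with i0; auto;
      [intros k Hk; pose proof (Hws k Hk) | pose proof (Hws i0 Hi0)]; lra. }
  assert (HBU : forall x, 0 < x < 1 -> benefitU K f c v x = m * (1 - hmean x)).
  { intros x Hx; unfold benefitU.
    rewrite (expect_ext _ _ _ (fun k => (1 - hmean x) * w k))
      by (intros; rewrite benefit_hmean by exact Hx; apply Rmult_comm).
    rewrite expect_scal; apply Rmult_comm. }
  assert (Hright : forall Q, qU <= Q < 1 -> m * (1 - hmean Q) <= s).
  { intros Q HQ; apply (stable_right (benefitU K f c v)) with qU;
      [lra|assumption..]. }
  assert (HqU : 0 < qU < 1) by apply hqU.
  (* Equal intensities [Q] at two costs would force equal margins s / (1 - hmean Q). Hence the
     intensities are not concentrated at one point, which makes both Jensen inequalities strict. *)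
  assert (Hne : forall Q, exists k,
            (1 <= k <= K)%nat /\ 0 < f k /\ q k <> Q).
  { intros Q; destruct hrandom as (i & j & Hi & Hj & Hfi & Hfj & Hij).
    destruct (Req_dec (q i) Q) as [Ei|]; [|now exists i].
    destruct (Req_dec (q j) Q) as [Ej|]; [|now exists j].
    destruct (Hq i Hi) as [_ Wi], (Hq j Hj) as [_ Wj].
    rewrite Ei in Wi; rewrite Ej in Wj.
    assert (0 < 1 - hmean Q) by (pose proof (Hw i Hi); nra).
    assert (w j < w i) by (unfold w; lra).
    nra. }
  set (Eq := expect K f q).
  set (Eqw := expect K f (fun k => q k * (w k - s))).
  (* Otherwise [Hright] gives hmean Eq >= 1 - s / m, whereas Jensen gives hmean Eq < E (hmean (q k))
     <= 1 - s / m. *)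
  assert (HEq : Eq < qU).
  { apply Rnot_le_lt; intros Hle.
    assert (HQ : Eq < 1).
    { enough (0 < 1 - Eq) by lra.
      replace (1 - Eq) with (expect K f (fun k => 1 + -1 * q k))
        by (rewrite expect_plus, expect_scal, (expect_const _ _ _ hf);
            fold Eq; ring).
      apply expect_pos with i0; auto; intros; simpl.
      - destruct (Hq k H); lra.
      - destruct (Hq i0 Hi0); lra. }
    pose proof (Hright Eq ltac:(lra)) as HB.
    destruct (hmean_convex Eq) as [D HD]; [lra|].
    destruct (Hne Eq) as (i & Hi & Hfi & Hqi).
    (* [1 / w k >= 2 / m - w k / m ^ 2] bounds [hmean (q k) = 1 - s / w k]
       from above by a function affine in [w k]. *)
    assert (Hup : forall k, (1 <= k <= K)%nat ->
      hmean (q k) <= 1 - 2 * s / m + s / m ^ 2 * w k).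
    { intros k Hk; destruct (Hq k Hk) as [_ H]; pose proof (Hw k Hk).
      replace (hmean (q k)) with (1 - s / w k)
        by (rewrite <- H; field; lra).
      enough (0 <= s * (w k - m) ^ 2 / (w k * m ^ 2)) as HH.
      { replace (s * (w k - m) ^ 2 / (w k * m ^ 2))
          with (s / w k - 2 * s / m + s / m ^ 2 * w k) in HH by (field; lra).
        lra. }
      apply Rmult_le_pos;
        [apply Rmult_le_pos; [lra|apply pow2_ge_0]|].
      apply Rlt_le, Rinv_0_lt_compat, Rmult_lt_0_compat; [lra|].
      apply pow_lt; lra. }
    (* Each term adds the slack in [Hup] to the gap above the tangent at [Eq]. On averaging, the
       terms in [D] cancel and 1 - s / m - hmean Eq remains. *)
    assert (Hpos : 0 < expect K f (fun k =>
      (1 - 2 * s / m - hmean Eq - D * Eq) + (s / m ^ 2 * w k + D * q k))).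
    { apply expect_pos with i; auto.
      - intros k Hk; pose proof (Hup k Hk); destruct (Hq k Hk) as [H1 _].
        destruct (Req_dec (q k) Eq) as [E|E];
          [rewrite E in *; lra|pose proof (HD _ H1 E); lra].
      - pose proof (Hup i Hi); destruct (Hq i Hi) as [H1 _].
        pose proof (HD _ H1 Hqi); lra. }
    rewrite !expect_plus, !expect_scal, (expect_const _ _ _ hf) in Hpos.
    fold Eq m in Hpos.
    replace (s / m ^ 2 * m) with (s / m) in Hpos by (field; lra).
    replace (2 * s / m) with (s / m + s / m) in Hpos by (field; lra).
    assert (m * (s / m) = s) by (field; lra).
    nra. }
  assert (HEqw : Eqw < qU * (m - s)).
  { apply Rnot_le_lt; intros Hle.
    (* The mean of [q k] under the weights f k (w k - s), whose total is [m - s]. *)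
    set (Q := Eqw / (m - s)).
    assert (EQ : Eqw = Q * (m - s)) by (unfold Q; field; lra).
    assert (HQU : qU <= Q) by nra.
    assert (HQ : Q < 1).
    { enough (0 < (m - s) - Eqw) by nra.
      replace ((m - s) - Eqw) with
        (expect K f (fun k => (w k + - s) + -1 * (q k * (w k - s))))
        by (rewrite !expect_plus, expect_scal, (expect_const _ _ _ hf);
            fold m Eqw; ring).
      assert (H : forall k, (1 <= k <= K)%nat ->
                0 < (w k + - s) + -1 * (q k * (w k - s))).
      { intros k Hk; destruct (Hq k Hk); pose proof (Hws k Hk); nra. }
      apply expect_pos with i0; auto; intros; apply Rlt_le, H; assumption. }
    pose proof (Hright Q ltac:(lra)) as HB.
    destruct (hmean_tangent Q) as [D HD]; [lra|].
    pose proof (hmean_pos Q ltac:(lra)) as HgQ.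
    destruct (Hne Q) as (i & Hi & Hfi & Hqi).
    (* This is the tangent inequality at [Q] times [w k], rewritten with w k * hmean (q k) = w k -
       s. In the average the terms in [D] cancel by the choice of [Q], leaving m (1 - hmean Q) > s,
       against [HB]. *)
    assert (Hk : forall k, (1 <= k <= K)%nat -> q k <> Q ->
      0 < (hmean Q - D * Q) * (w k + - s) + (D * (q k * (w k - s))
          + - hmean Q ^ 2 * w k)).
    { intros k Hk E; destruct (Hq k Hk) as [H1 H2].
      pose proof (HD _ H1 E) as H3; pose proof (Hw k Hk) as H4.
      assert (w k - s = w k * hmean (q k)) as H5 by lra.
      enough (0 < w k * (hmean (q k) * (hmean Q + D * (q k - Q)) - hmean Q ^ 2))
        by (replace (w k + - s) with (w k * hmean (q k)) by lra;
            rewrite H5; lra).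
      apply Rmult_lt_0_compat; lra. }
    assert (Hpos : 0 < expect K f (fun k =>
      (hmean Q - D * Q) * (w k + - s) + (D * (q k * (w k - s))
          + - hmean Q ^ 2 * w k))).
    { apply expect_pos with i; auto.
      intros k Hk1; destruct (Req_dec (q k) Q) as [E|E];
        [|apply Rlt_le; auto].
      destruct (Hq k Hk1) as [_ H2]; rewrite E in *.
      apply Req_le; rewrite <- H2; ring. }
    rewrite !expect_plus, !expect_scal, expect_plus, (expect_const _ _ _ hf)
      in Hpos.
    fold m Eqw in Hpos; rewrite EQ in Hpos.
    assert (0 < hmean Q * ((m - s) - hmean Q * m)) by lra.
    nra. }
  assert (EEqw : expect K f (fun k => q k * w k) = Eqw + s * Eq).
  { unfold Eqw, Eq; rewrite <- expect_scal, <- expect_plus.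
    apply expect_ext; intros; ring. }
  assert (HN : 0 < INR N) by (apply lt_0_INR; lia).
  assert (HCSU : CSU K f c v s qU = qU * (m - s)).
  { unfold CSU.
    rewrite (expect_ext _ _ _ (fun k => v + - qU * w k))
      by (intros; rewrite expenditure_eq by exact HqU; unfold w; ring).
    rewrite expect_plus, expect_scal, (expect_const _ _ _ hf); fold m; ring. }
  assert (HCS : forall k, (1 <= k <= K)%nat ->
            CS v s (c k) (q k) = q k * (w k - s)).
  { intros k Hk; destruct (Hq k Hk) as [H1 _]; unfold CS.
    rewrite expenditure_eq by exact H1; unfold w; ring. }
  assert (HPU : profitU N K f c v qU = (1 - qU) * m / INR N).
  { unfold profitU.
    rewrite (expect_ext _ _ _ (fun k => (1 - qU) / INR N * w k))
      by (intros; unfold profit, w; field; lra).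
    rewrite expect_scal; fold m; field; lra. }
  assert (HP : expect K f (fun k => profit N v (c k) (q k))
               = (m - (Eqw + s * Eq)) / INR N).
  { rewrite (expect_ext _ _ _
      (fun k => / INR N * (w k + -1 * (q k * w k))))
      by (intros; unfold profit, w; field; lra).
    rewrite expect_scal, expect_plus, expect_scal, EEqw; fold m; field; lra. }
  rewrite expect_plus, expect_scal, HCSU, HPU, HP, (expect_ext _ _ _ _ HCS).
  fold Eqw Eq.
  repeat split.
  - exact HEq.
  - exact HEqw.
  (* Adding [HEqw] to s times [HEq] gives Eqw + s Eq < qU m. *)
  - apply Rmult_lt_compat_r; [now apply Rinv_0_lt_compat|].
    assert (s * Eq < s * qU) by (now apply Rmult_lt_compat_l). lra.
  (* The two total surpluses reduce to m - s qU and m - s Eq. *)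
  - assert (s * Eq < s * qU) by (now apply Rmult_lt_compat_l).
    field_simplify; lra.
Qed.
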